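(* Let $R$ be a commutative ring. Then every pure projective $1$-tilting $R$-module is projective, and therefore classical.
   Context: A module is pure projective if it is a direct summand of a direct sum of finitely presented modules. An $R$-module $T$ is $1$-tilting if $\operatorname{pd}T\le 1$, $\operatorname{Ext}^1_R(T,T^{(\lambda)})=0$ for all cardinals $\lambda$, and there is an exact sequence $0\to R\to T_0\to T_1\to 0$ with $T_0,T_1$ direct summands of direct sums of copies of $T$. $T$ is classical if $T^{\perp}=U^{\perp}$ for some finitely presented $1$-tilting module $U$, where $X^{\perp}=\{M:\operatorname{Ext}^1_R(X,M)=0\}$. *)

(* Defs.v *)
From mathcomp Require Import all_boot all_algebra.
Set Implicit Arguments. Unset Strict Implicit. Unset Printing Implicit Defensive.
Import GRing.Theory.
Local Open Scope ring_scope.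

Section ModuleTheory.
Variable R : comPzRingType.

Definition lin (M N : lmodType R) (f : M -> N) : Prop :=
  forall (a : R) (x y : M), f (a *: x + y) = a *: f x + f y.

Definition surj (A B : Type) (f : A -> B) : Prop := forall b, exists a, f a = b.

Definition short_exact (A B C : lmodType R) (f : A -> B) (g : B -> C) : Prop :=
  [/\ lin f, lin g, injective f, surj g &
      forall b, g b = 0 <-> exists a, f a = b].

Definition projective (P : lmodType R) : Prop :=
  forall (M N : lmodType R) (g : M -> N) (f : P -> N),
    lin g -> surj g -> lin f ->
    exists h : P -> M, lin h /\ forall x, g (h x) = f x.

(* Ext^1_R(X, M) = 0 (Yoneda description): every extension
   0 -> M -> E -> X -> 0 splits. *)
Definition Ext1_vanishes (X M : lmodType R) : Prop :=
  forall (E : lmodType R) (i : M -> E) (p : E -> X),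
    short_exact i p ->
    exists s : X -> E, lin s /\ forall x, p (s x) = x.

Definition pd_le1 (X : lmodType R) : Prop :=
  exists (P1 P0 : lmodType R) (j : P1 -> P0) (q : P0 -> X),
    [/\ projective P1, projective P0 & short_exact j q].

Definition fin_pres (M : lmodType R) : Prop :=
  exists (n : nat) (v : 'I_n -> M),
    (forall x : M, exists c : 'I_n -> R, x = \sum_(i < n) c i *: v i) /\
    exists (k : nat) (w : 'I_k -> 'I_n -> R),
      forall c : 'I_n -> R,
        (\sum_(i < n) c i *: v i = 0) <->
        exists d : 'I_k -> R, forall i, c i = \sum_(j < k) d j * w j i.

Definition is_dsum (I : Type) (F : I -> lmodType R) (S : lmodType R)
    (iota : forall i, F i -> S) : Prop :=
  (forall i, lin (iota i)) /\
  forall (N : lmodType R) (f : forall i, F i -> N), (forall i, lin (f i)) ->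
    exists g : S -> N,
      [/\ lin g, (forall i x, g (iota i x) = f i x) &
          forall g' : S -> N, lin g' -> (forall i x, g' (iota i x) = f i x) ->
            forall s, g' s = g s].

Definition dsummand (X S : lmodType R) : Prop :=
  exists (s : X -> S) (r : S -> X), [/\ lin s, lin r & forall x, r (s x) = x].

Definition pure_projective (M : lmodType R) : Prop :=
  exists (I : Type) (F : I -> lmodType R) (S : lmodType R)
         (iota : forall i, F i -> S),
    [/\ forall i, fin_pres (F i), is_dsum iota & dsummand M S].

Definition in_Add (T X : lmodType R) : Prop :=
  exists (I : Type) (S : lmodType R) (iota : I -> T -> S),
    is_dsum (F := fun _ : I => T) iota /\ dsummand X S.

Definition tilting1 (T : lmodType R) : Prop :=
  [/\ pd_le1 T,
      (forall (I : Type) (S : lmodType R) (iota : I -> T -> S),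
          is_dsum (F := fun _ : I => T) iota -> Ext1_vanishes T S) &
      exists (T0 T1 : lmodType R) (a : R^o -> T0) (b : T0 -> T1),
        [/\ in_Add T T0, in_Add T T1 & short_exact a b]].

Definition classical (T : lmodType R) : Prop :=
  exists U : lmodType R,
    [/\ fin_pres U, tilting1 U &
        forall M : lmodType R, Ext1_vanishes T M <-> Ext1_vanishes U M].

End ModuleTheory.

(* Main.v *)
(** Fix a projective resolution [0 -> P1 -> P0 -q-> T -> 0] and exhibit [T] as a
summand of a direct sum of finitely presented modules [F i]; the goal is to
split [q].

Since a direct sum is the union of its finite subsums, every finite family [x]
in [T] is fixed by a composite [T -c-> B -g-> T] with [B] finitely presented.
The embedding of [R] into a summand of a sum of copies of [T] provides a finite
family [x] in [T] with zero annihilator.  If [T = mT] for a maximal ideal [m],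
then [c g] maps [B] into [mB], and the Cayley-Hamilton theorem yields an element
of [1 + m] that kills [x], which is absurd.  Hence [T <> mT], and since every map
[P1 -> T] extends to [P0], [P1 :&: mP0 = mP1].

For [f : A -> T] with [A] finitely presented, the scalars [b] such that [b f]
lifts through [q] form an ideal.  For each maximal ideal [m] it meets [1 + m]:
with [g c f = f], the condition on [P1] makes some lift of [c g] to a free
presentation of [B] act on the relation module as an endomorphism that vanishes
modulo [m], and Cayley-Hamilton inverts one minus this endomorphism up to a
factor in [1 + m].  So every map [F i -> T] lifts to [P0], and the lifts
assemble to a section of [q]. *)

From Stdlib Require List.
From HB Require Import structures.
From mathcomp Require Import all_boot all_algebra.
From mathcomp Require Import boolp classical_sets functions.
Require Import Defs.
Set Implicit Arguments. Unset Strict Implicit. Unset Printing Implicit Defensive.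
Import GRing.Theory.
Local Open Scope ring_scope.

(** * Linear maps, submodules and quotient modules *)

Section LinearMaps.
Variable R : comPzRingType.
Implicit Types M N P : lmodType R.

Lemma linD M N (f : M -> N) : lin f -> {morph f : x y / x + y}.
Proof. by move=> hf x y; rewrite -[x]scale1r hf !scale1r. Qed.

Lemma lin0 M N (f : M -> N) : lin f -> f 0 = 0.
Proof. by move=> hf; apply: (addIr (f 0)); rewrite -linD // !add0r. Qed.

Lemma linZ M N (f : M -> N) : lin f -> forall a x, f (a *: x) = a *: f x.
Proof. by move=> hf a x; rewrite -[a *: x]addr0 hf lin0 // addr0. Qed.

Lemma linN M N (f : M -> N) : lin f -> {morph f : x / - x}.
Proof. by move=> hf x; rewrite -scaleN1r linZ // scaleN1r. Qed.

Lemma linB M N (f : M -> N) : lin f -> {morph f : x y / x - y}.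
Proof. by move=> hf x y; rewrite linD // linN. Qed.

Lemma lin_sum M N (f : M -> N) (J : Type) (r : seq J) (F : J -> M) :
  lin f -> f (\sum_(i <- r) F i) = \sum_(i <- r) f (F i).
Proof. by move=> hf; apply: big_morph; [exact: linD | exact: lin0]. Qed.

Lemma lin_id M : lin (fun x : M => x).
Proof. by []. Qed.

Lemma lin_zero M N : lin (fun _ : M => 0 : N).
Proof. by move=> a x y; rewrite scaler0 addr0. Qed.

Lemma lin_comp M N P (g : N -> P) (f : M -> N) :
  lin g -> lin f -> lin (fun x => g (f x)).
Proof. by move=> hg hf a x y; rewrite hf hg. Qed.

Lemma lin_add M N (f g : M -> N) : lin f -> lin g -> lin (fun x => f x + g x).
Proof.
by move=> hf hg a x y; rewrite hf hg scalerDr !addrA; congr (_ + _); rewrite addrAC.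
Qed.

Lemma lin_scale M N b (f : M -> N) : lin f -> lin (fun x => b *: f x).
Proof. by move=> hf a x y; rewrite hf scalerDr !scalerA mulrC. Qed.

Lemma lin_opp M N (f : M -> N) : lin f -> lin (fun x => - f x).
Proof. by move=> hf a x y; rewrite hf opprD scalerN. Qed.

Lemma lin_mulmxr m n p (A : 'M[R]_(n, p)) : lin (fun c : 'M[R]_(m, n) => c *m A).
Proof. by move=> a x y; rewrite mulmxDl scalemxAl. Qed.

Lemma lin_factor M N P (p : M -> N) (f : M -> P) :
  lin p -> surj p -> lin f -> (forall x, p x = 0 -> f x = 0) ->
  exists g : N -> P, lin g /\ forall x, g (p x) = f x.
Proof.
move=> hp sp hf hk; have [s ps] := choice sp.
have gp x : f (s (p x)) = f x.
  by apply/eqP; rewrite -subr_eq0 -linB // hk // linB // ps subrr.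
exists (f \o s); split=> [a x y|] //=.
have -> : a *: x + y = p (a *: s x + s y) by rewrite hp !ps.
by rewrite gp hf.
Qed.

Lemma lin_lift_inj M N P (i : M -> N) (f : P -> N) :
  lin i -> injective i -> lin f -> (forall x, exists y, i y = f x) ->
  exists g : P -> M, lin g /\ forall x, i (g x) = f x.
Proof.
move=> hi ii hf /choice[g gP]; exists g; split=> // a x y.
by apply: ii; rewrite hi !gP hf.
Qed.

Section Submodule.
Variables (V : lmodType R) (P : V -> Prop).
Hypotheses (P0 : P 0) (PD : forall a x y, P x -> P y -> P (a *: x + y)).

Definition sub_pred : pred V := fun x => `[< P x >].

Fact sub_pred_closed : GRing.submod_closed sub_pred.
Proof.
by split=> [|a x y /asboolP Px /asboolP Py]; apply/asboolP => //; apply: PD.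
Qed.
HB.instance Definition _ := GRing.isSubmodClosed.Build R V sub_pred sub_pred_closed.

Record submodule := Submodule { sub_val :> V; _ : sub_val \in sub_pred }.
HB.instance Definition _ := [isSub for sub_val].
HB.instance Definition _ := [Choice of submodule by <:].
HB.instance Definition _ := [SubChoice_isSubLmodule of submodule by <:].

Lemma submodule_exists :
  exists (U : lmodType R) (i : U -> V),
    [/\ lin i, injective i & forall x, P x <-> exists u, i u = x].
Proof.
exists submodule, val; split=> [a x y||x].
- by rewrite GRing.valD GRing.valZ.
- exact: val_inj.
split=> [Px|[[y yP] <-]]; last exact/asboolP.
have xP : x \in sub_pred by apply/asboolP.
by exists (Submodule xP).
Qed.
End Submodule.

Section Quotient.
Variables (V : lmodType R) (P : V -> Prop).
Hypotheses (P0 : P 0) (PD : forall a x y, P x -> P y -> P (a *: x + y)).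

Let PZ a x : P x -> P (a *: x).
Proof. by move=> Px; rewrite -[_ *: _]addr0; apply: PD. Qed.
Let PA x y : P x -> P y -> P (x + y).
Proof. by move=> Px Py; rewrite -[x]scale1r; apply: PD. Qed.
Let PN x : P (- x) -> P x.
Proof. by move=> /(PZ (-1)); rewrite scaleN1r opprK. Qed.

(** [choose] returns the same point for extensionally equal predicates, so [coset_repr] is constant
    on cosets of [P]. The quotient can then be the subtype of its fixed points. *)
Definition coset_repr (x : V) : V := choose (fun y => `[< P (y - x) >]) x.

Let reprP x : P (coset_repr x - x).
Proof.
apply/asboolP; apply: (@chooseP _ (fun y => `[< P (y - x) >])).
by apply/asboolP; rewrite subrr.
Qed.

Let repr_eq x y : P (x - y) -> coset_repr x = coset_repr y.
Proof.
move=> Pxy; rewrite /coset_repr.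
have e : (fun z => `[< P (z - x) >]) =1 (fun z => `[< P (z - y) >]).
  move=> z; apply/asboolP/asboolP => Pz.
    by rewrite -[z](subrK x) -addrA; apply: PA.
  apply: PN; rewrite opprB -[x](subrK y) -addrA; apply: PA => //.
  by apply: PN; rewrite opprB.
rewrite (eq_choose e); apply: choose_id; apply/asboolP => //.
by rewrite subrr.
Qed.

Record quotient := Quotient { quot_repr : V; _ : coset_repr quot_repr == quot_repr }.
HB.instance Definition _ := [isSub for quot_repr].
HB.instance Definition _ := [Choice of quotient by <:].

Fact coset_repr_idem x : coset_repr (coset_repr x) == coset_repr x.
Proof. by apply/eqP/repr_eq. Qed.
Definition quot_proj x := Quotient (coset_repr_idem x).

Let projP x y : P (x - y) -> quot_proj x = quot_proj y.
Proof. by move=> Pxy; apply: val_inj; apply: repr_eq. Qed.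
Let reprK (u : quotient) : quot_proj (quot_repr u) = u.
Proof. by apply: val_inj; apply/eqP; case: u. Qed.

Definition quot_add u v := quot_proj (quot_repr u + quot_repr v).
Definition quot_opp u := quot_proj (- quot_repr u).
Definition quot_scale a u := quot_proj (a *: quot_repr u).

Let addE x y : quot_add (quot_proj x) (quot_proj y) = quot_proj (x + y).
Proof.
by apply: projP; rewrite /= opprD addrACA; apply: PA.
Qed.
Let oppE x : quot_opp (quot_proj x) = quot_proj (- x).
Proof. by apply: projP; rewrite /= -opprD; apply: PN; rewrite opprK. Qed.
Let scaleE a x : quot_scale a (quot_proj x) = quot_proj (a *: x).
Proof. by apply: projP; rewrite /= -scalerBr; apply: PZ. Qed.

Fact quot_addA : associative quot_add.
Proof. by move=> u v w; rewrite -(reprK u) -(reprK v) -(reprK w) !addE addrA. Qed.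
Fact quot_addC : commutative quot_add.
Proof. by move=> u v; rewrite -(reprK u) -(reprK v) !addE addrC. Qed.
Fact quot_add0 : left_id (quot_proj 0) quot_add.
Proof. by move=> u; rewrite -(reprK u) addE add0r. Qed.
Fact quot_addN : left_inverse (quot_proj 0) quot_opp quot_add.
Proof. by move=> u; rewrite -(reprK u) oppE addE addNr. Qed.
HB.instance Definition _ :=
  GRing.isZmodule.Build quotient quot_addA quot_addC quot_add0 quot_addN.

Fact quot_scaleA a b u : quot_scale a (quot_scale b u) = quot_scale (a * b) u.
Proof. by rewrite -(reprK u) !scaleE scalerA. Qed.
Fact quot_scale1 : left_id 1 quot_scale.
Proof. by move=> u; rewrite -(reprK u) scaleE scale1r. Qed.
Fact quot_scaleDr : right_distributive quot_scale +%R.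
Proof.
move=> a u v; transitivity (quot_proj (a *: (quot_repr u + quot_repr v))).
  exact: scaleE.
by rewrite scalerDr; exact/esym/addE.
Qed.
Fact quot_scaleDl u : {morph quot_scale^~ u : a b / a + b}.
Proof.
move=> a b; transitivity (quot_proj (a *: quot_repr u + b *: quot_repr u)).
  by rewrite -scalerDl.
exact/esym/addE.
Qed.
HB.instance Definition _ := GRing.Zmodule_isLmodule.Build R quotient
  quot_scaleA quot_scale1 quot_scaleDr quot_scaleDl.

Lemma quotient_exists :
  exists (Q : lmodType R) (p : V -> Q),
    [/\ lin p, surj p & forall x, p x = 0 <-> P x].
Proof.
exists quotient, quot_proj; split=> [a x y|u|x].
- transitivity (quot_add (quot_proj (a *: x)) (quot_proj y)); first exact/esym/addE.
  by rewrite -scaleE.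
- by exists (quot_repr u).
split=> [[e]|Px]; last by apply: projP; rewrite subr0.
apply: PN; rewrite -[x](subrK (coset_repr x)) opprD.
rewrite opprB; apply: PA; rewrite // e.
by apply: PN; rewrite opprK -[coset_repr 0]subr0.
Qed.
End Quotient.
End LinearMaps.

(** * Ideals, maximal ideals and the submodules [mV] *)

Section Ideals.
Variable R : comPzRingType.
Implicit Types (M N V : lmodType R) (m : R -> Prop).

Definition ideal m := m 0 /\ forall a x y, m x -> m y -> m (a * x + y).

(** Maximality is encoded as invertibility modulo [m] of every scalar outside [m], that is, as [R/m]
    being a field. *)
Definition maximal_ideal m :=
  [/\ ideal m, ~ m 1 & forall a, ~ m a -> exists b, m (1 - b * a)].

Lemma idealD m x y : ideal m -> m x -> m y -> m (x + y).
Proof. by move=> [_ mD] mx my; rewrite -[x]mul1r; apply: mD. Qed.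

Lemma idealM m a x : ideal m -> m x -> m (a * x).
Proof. by move=> [m0 mD] mx; rewrite -[_ * _]addr0; apply: mD. Qed.

Lemma idealN m x : ideal m -> m x -> m (- x).
Proof. by move=> mI mx; rewrite -mulN1r; apply: idealM. Qed.

Lemma idealB m x y : ideal m -> m x -> m y -> m (x - y).
Proof. by move=> mI mx my; apply: idealD => //; apply: idealN. Qed.

Lemma ideal_sum m (J : Type) (r : seq J) (Q : pred J) (F : J -> R) :
  ideal m -> (forall i, Q i -> m (F i)) -> m (\sum_(i <- r | Q i) F i).
Proof.
move=> mI mF; elim/big_ind: _ => //; first by case: mI.
by move=> x y; apply: idealD.
Qed.

Lemma maximal_ideal_exists (J : R -> Prop) :
  ideal J -> ~ J 1 -> exists m, maximal_ideal m /\ forall a, J a -> m a.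
Proof.
move=> JI J1.
(* Adjoining [J] inside the predicate lets the empty chain, whose union is empty, satisfy it too. *)
pose P (A : set R) := ideal (fun a => A a \/ J a) /\ ~ (A 1 \/ J 1).
have [A [[AI A1] Amax]] : exists A, P A /\ forall B, (A `<` B)%classic -> ~ P B.
  apply: Zorn_bigcup => F FP Ftot.
  split; last by case=> // -[B FB B1]; case: (FP _ FB) => _ []; left.
  split; first by right; case: JI.
  move=> a x y [[B FB Bx]|Jx] [[C FC Cy]|Jy].
  - have [BC|CB] := Ftot _ _ FB FC.
      have [[_ D] _] := FP _ FC.
      have [?|?] := D a x y (or_introl (BC _ Bx)) (or_introl Cy); last by right.
      by left; exists C.
    have [[_ D] _] := FP _ FB.
    have [?|?] := D a x y (or_introl Bx) (or_introl (CB _ Cy)); last by right.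
    by left; exists B.
  - have [[_ D] _] := FP _ FB.
    have [?|?] := D a x y (or_introl Bx) (or_intror Jy); last by right.
    by left; exists B.
  - have [[_ D] _] := FP _ FC.
    have [?|?] := D a x y (or_intror Jx) (or_introl Cy); last by right.
    by left; exists C.
  - by right; case: JI => _; apply.
pose m a := A a \/ J a.
exists m; split; last by right.
split=> // a ma; apply: contrapT => noinv.
(* The ideal [m + Ra]: it strictly contains [A], and it misses 1 as long as [a] has no inverse
   modulo [m]. *)
pose B : set R := fun x => exists b, m (x - b * a).
have mB x : m x -> B x by move=> mx; exists 0; rewrite mul0r subr0.
apply: (Amax B).
  split=> [x Ax|BA]; first by apply: mB; left.
  by apply: ma; left; apply: BA; exists 1; rewrite mul1r subrr; case: AI.
have -> : P B = (ideal B /\ ~ B 1).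
  rewrite /P; have -> : (fun a => B a \/ J a) = B.
    apply/funext => x; apply/propext; split=> [[//|Jx]|]; last by left.
    by apply: mB; right.
  by have -> : (B 1 \/ J 1) = B 1 by apply/propext; split=> [[]//|]; last by left.
split=> //; split; first by apply: mB; case: AI.
move=> c x y [b mx] [b' my]; exists (c * b + b').
rewrite mulrDl opprD addrACA -mulrA -mulrBr.
by case: AI => _; apply.
Qed.

(** The submodule [mV] when [m] is an ideal; membership is eliminated one summand at a time. *)
Inductive ideal_mul m V : V -> Prop :=
| ideal_mul0 : ideal_mul m 0
| ideal_mulD a x y : m a -> ideal_mul m y -> ideal_mul m (a *: x + y).

Lemma ideal_mul_gen m V a (x : V) : m a -> ideal_mul m (a *: x).
Proof. by move=> ma; rewrite -[_ *: _]addr0; apply: ideal_mulD ma (ideal_mul0 _ _). Qed.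

Lemma ideal_mul_add m V (x y : V) :
  ideal_mul m x -> ideal_mul m y -> ideal_mul m (x + y).
Proof.
elim=> [|a z t ma _ IH] hy; first by rewrite add0r.
by rewrite -addrA; apply: ideal_mulD ma _; apply: IH.
Qed.

Lemma ideal_mul_scale m V b (x : V) :
  ideal m -> ideal_mul m x -> ideal_mul m (b *: x).
Proof.
move=> mI; elim=> [|a z t ma _ IH]; first by rewrite scaler0; left.
by rewrite scalerDr scalerA; apply: ideal_mulD; first exact: idealM.
Qed.

Lemma ideal_mul_sum m V (J : Type) (r : seq J) (F : J -> V) :
  (forall i, ideal_mul m (F i)) -> ideal_mul m (\sum_(i <- r) F i).
Proof.
move=> mF; elim/big_ind: _ => //; first by left.
by move=> x y; apply: ideal_mul_add.
Qed.

Lemma ideal_mul_lin m M N (f : M -> N) x :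
  lin f -> ideal_mul m x -> ideal_mul m (f x).
Proof.
move=> hf; elim=> [|a z t ma _ IH]; first by rewrite lin0 //; left.
by rewrite hf; apply: ideal_mulD.
Qed.

End Ideals.

(** * Projectivity and extensions, seen modulo an ideal *)

Section Homological.
Variable R : comPzRingType.
Implicit Types (M N V P : lmodType R) (m : R -> Prop).

(* The free module on the set [P] appears here as the graph of its canonical
   map to [P], inside [(P -> R) * P]. *)
Lemma projective_detects_ideal_mul P m z :
  ideal m -> projective P -> (forall l : P -> R^o, lin l -> m (l z)) ->
  ideal_mul m z.
Proof.
move=> mI projP mz.
pose L (u : (P -> R^o) * P) := exists s : seq P, forall s', uniq s' ->
  {subset s <= s'} -> u.2 = \sum_(x <- s') u.1 x *: x.
have L0 : L 0.
  by exists [::] => s' _ _; rewrite big1 // => x _; rewrite scale0r.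
have LD a u v : L u -> L v -> L (a *: u + v).
  move=> [s su] [t tv]; exists (s ++ t) => s' us' sub /=.
  rewrite (su s') // ?(tv s') //; last first.
  - by move=> x xs; apply: sub; rewrite mem_cat xs.
  - by move=> x xt; apply: sub; rewrite mem_cat xt orbT.
  rewrite scaler_sumr -big_split; apply: eq_bigr => x _ /=.
  by rewrite scalerA -scalerDl.
have [U [i [li ii iP]]] := submodule_exists L0 LD.
have sg : surj (fun u : U => (i u).2).
  move=> x; pose dx : P -> R^o := fun y => (x == y)%:R.
  have /iP[u ux] : L (dx, x); last by exists u; rewrite ux.
  exists [:: x] => s' us' sub /=.
  rewrite (bigD1_seq x) //=; last by apply: sub; rewrite inE.
  rewrite /dx eqxx scale1r big1 ?addr0 // => y yx.
  by rewrite eq_sym (negPf yx) scale0r.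
have lg : lin (fun u : U => (i u).2) by move=> a u v; rewrite li.
have [h [lh hz]] := projP _ _ _ _ lg sg (@lin_id R P).
have [s /(_ _ (undup_uniq s))] : L (i (h z)) by apply/iP; exists (h z).
rewrite hz => -> => [|x]; last by rewrite mem_undup.
apply: ideal_mul_sum => x; apply: ideal_mul_gen.
(* Each coordinate of the section [h] is a linear form on [P], so its value at [z] lies in [m]. *)
by apply: (mz (fun y => (i (h y)).1 x)) => a u v; rewrite lh li.
Qed.

(* The extension applied here is the pushout of [0 -> A -> B -> C -> 0] along [f]. *)
Lemma Ext1_vanishes_extend (A B C M : lmodType R) (j : A -> B) (q : B -> C) (f : A -> M) :
  short_exact j q -> Ext1_vanishes C M -> lin f ->
  exists h : B -> M, lin h /\ forall x, h (j x) = f x.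
Proof.
move=> [lj lq ij sq kq] ext lf.
pose K (u : (M * B)%type) := exists x, u = (f x, - j x).
have K0 : K 0 by exists 0; rewrite (lin0 lf) (lin0 lj) oppr0.
have KD a u v : K u -> K v -> K (a *: u + v).
  move=> [x ->] [y ->]; exists (a *: x + y).
  by rewrite lf lj opprD -scalerN.
have [E [p [lp sp kp]]] := quotient_exists K0 KD.
pose i (t : M) := p (t, 0).
have li : lin i.
  by move=> a x y; rewrite -lp; congr p; rewrite /= [RHS]surjective_pairing /= scaler0 addr0.
have lq2 : lin (fun u : (M * B)%type => q u.2) by move=> a u v; rewrite /= lq.
have [|r [lr rp]] := lin_factor lp sp lq2.
  move=> u /kp[x ->] /=; rewrite linN //; apply/eqP; rewrite oppr_eq0.
  by apply/eqP/kq; exists x.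
have ii : injective i.
  move=> x y /eqP; rewrite -subr_eq0 -linB // => /eqP/kp[z [e /esym/eqP]].
  rewrite oppr_eq0 -(lin0 lj) => /eqP/ij z0.
  by apply/eqP; rewrite -subr_eq0 e z0 lin0.
have ex : short_exact i r.
  split=> // [c|e]; first by have [b <-] := sq c; exists (p (0, b)); rewrite rp.
  split=> [|[t <-]]; last by rewrite rp /= lin0.
  have [[t b] <-] := sp e; rewrite rp /= => /kq[x <-].
  exists (t + f x); apply/eqP; rewrite /i -subr_eq0 -(linB lp); apply/eqP/kp; exists x.
  by congr pair; rewrite /= ?sub0r // addrC addKr.
have [s [ls rs]] := ext _ _ _ ex.
have lp0 : lin (fun b : B => p (0, b)).
  by move=> a x y; rewrite -lp; congr p; rewrite [RHS]surjective_pairing /= scaler0 addr0.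
(* Correcting the canonical map [B -> E] by the splitting [s] gives a map killed by [r], which
   therefore takes its values in [M]. *)
have [||h [lh hP]] := @lin_lift_inj _ _ _ _ i (fun b => p (0, b) - s (q b)) li ii.
- apply: (lin_add lp0); apply: lin_opp; exact: lin_comp.
- by move=> b; case: ex => _ _ _ _ kr; apply/kr; rewrite linB // rs rp subrr.
exists h; split=> // x; apply: ii; rewrite hP.
have -> : q (j x) = 0 by apply/kq; exists x.
rewrite (lin0 ls) subr0; apply/eqP; rewrite /i eq_sym -subr_eq0 -(linB lp).
by apply/eqP/kp; exists x; congr pair; rewrite /= ?sub0r // subr0.
Qed.

(** If [z] were outside [mP1], some linear form [l] on [P1] would have [l z] outside [m]. The map
    [x |-> l x *: t] extends to [P0], so [j z] in [mP0] forces [l z *: t] into [mM]; as [l z] is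
    invertible modulo [m], [t] would lie in [mM]. *)
Lemma ideal_mul_ker M P0 P1 (j : P1 -> P0) (q : P0 -> M) m t z :
  maximal_ideal m -> short_exact j q -> projective P1 -> Ext1_vanishes M M ->
  ~ ideal_mul m (t : M) -> ideal_mul m (j z) -> ideal_mul m z.
Proof.
move=> [mI m1 minv] ex pr1 ext mt mjz.
apply: projective_detects_ideal_mul => // l ll.
apply: contrapT => /minv[b mb]; apply: mt.
have llt : lin (fun x => (l x : R) *: t).
  by move=> a x y; rewrite ll scalerDl scalerA.
have [h [lh hj]] := Ext1_vanishes_extend ex ext llt.
have /(ideal_mul_scale b mI) := ideal_mul_lin lh mjz.
rewrite hj scalerA => ht; rewrite -[t]scale1r -[1](subrK (b * l z)) scalerDl.
by apply: ideal_mul_add => //; apply: ideal_mul_gen.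
Qed.

End Homological.

(** * Matrices modulo an ideal *)

Section MatricesModIdeal.
Variables (R : comPzRingType) (m : R -> Prop).
Hypothesis mI : ideal m.

Definition mx_mod n p (A : 'M[R]_(n, p)) := forall i j, m (A i j).

Lemma mx_mod0 n p : mx_mod (0 : 'M_(n, p)).
Proof. by move=> i j; rewrite mxE; case: mI. Qed.

Lemma mx_modD n p (A B : 'M_(n, p)) : mx_mod A -> mx_mod B -> mx_mod (A + B).
Proof. by move=> mA mB i j; rewrite mxE; apply: idealD. Qed.

Lemma mx_modN n p (A : 'M_(n, p)) : mx_mod A -> mx_mod (- A).
Proof. by move=> mA i j; rewrite mxE; apply: idealN. Qed.

Lemma mx_mod_mull n p r (A : 'M_(n, p)) (B : 'M_(p, r)) :
  mx_mod A -> mx_mod (A *m B).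
Proof.
move=> mA i j; rewrite mxE; apply: ideal_sum => // l _.
by rewrite mulrC; apply: idealM.
Qed.

Lemma mx_mod_mulr n p r (A : 'M_(n, p)) (B : 'M_(p, r)) :
  mx_mod B -> mx_mod (A *m B).
Proof. by move=> mB i j; rewrite mxE; apply: ideal_sum => // l _; apply: idealM. Qed.

Lemma det_1sub_mod n (A : 'M[R]_n) : mx_mod A -> m (1 - \det (1%:M - A)).
Proof.
move=> mA; elim: n A mA => [|n IH] A mA; first by rewrite det_mx00 subrr; case: mI.
rewrite (expand_det_row _ ord0) big_ord_recl opprD addrA.
apply: idealB => //; last first.
  apply: ideal_sum => // i _; rewrite mulrC !mxE /= sub0r mulrN.
  by apply: idealN => //; apply: idealM.
rewrite /cofactor !mxE eqxx /= expr0 mul1r mulrBl mul1r opprB addrCA addrC.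
apply: idealD => //; last by rewrite mulrC; apply: idealM.
have -> : row' ord0 (col' ord0 (1%:M - A)) =
    1%:M - row' ord0 (col' ord0 A).
  by apply/matrixP => i j; rewrite !mxE.
by apply: IH => i j; rewrite !mxE.
Qed.

(* A generalized inverse of [W] over the field [R/m], built by adding one row at a time. *)
Lemma mx_regular_mod k n (W : 'M[R]_(k, n)) :
  maximal_ideal m -> exists C : 'M_(n, k), mx_mod (W - W *m C *m W).
Proof.
move=> [_ _ minv]; elim: k W => [|k IH] W; first by exists 0 => i; case: i.
rewrite -[k.+1]/(1 + k)%N in W *; rewrite -[W]vsubmxK.
move: (usubmx W) (dsubmx W) => r {}W.
(* [r'] is what remains of the new row [r] after reduction by the rows of [W]. If it vanishes modulo
   [m], a zero column completes [C]. *)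
have [C mC] := IH W; move r'E: (r - r *m C *m W) => r'.
have [mr|/existsNP[i /existsNP[j mr]]] := pselect (mx_mod r').
  exists (row_mx 0 C); rewrite -mulmxA mul_row_col mul0mx add0r.
  rewrite mul_col_mx opp_col_mx add_col_mx.
  move=> i j; rewrite mxE; case: (fintype.split i) => l; last by rewrite mulmxA; apply: mC.
  by rewrite mulmxA r'E; apply: mr.
(* Otherwise an entry of [r'] is invertible modulo [m], which gives a column [c] with [r' c = 1]
   modulo [m]. Replacing it by [c'] keeps this and also makes [W c'] vanish modulo [m]. *)
have [b mb] := minv _ mr.
pose c : 'M_(n, 1) := b *: delta_mx j 0.
move c'E: (c - C *m W *m c) => c'.
have mr'W : mx_mod (r' *m C *m W).
  have -> : r' *m C *m W = r *m C *m (W - W *m C *m W).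
    by rewrite -r'E mulmxBr !mulmxBl !mulmxA.
  exact: mx_mod_mulr.
have mWc' : mx_mod (W *m c').
  by rewrite -c'E mulmxBr !mulmxA -mulmxBl; apply: mx_mod_mull.
have mr'c : mx_mod (1%:M - r' *m c').
  rewrite -c'E mulmxBr !mulmxA opprB addrCA; apply: mx_modD; first exact: mx_mod_mull.
  move=> u v; rewrite !ord1 /c -scalemxAr -colE !mxE eqxx -(ord1 i).
  exact: mb.
have mrCWc' : mx_mod (1%:M - r *m c').
  have -> : r = r' + r *m C *m W by rewrite -r'E subrK.
  rewrite mulmxDl opprD addrA; apply: mx_modD => //; apply: mx_modN.
  by rewrite -mulmxA; apply: mx_mod_mulr.
(* Chosen so that its product with the stacked matrix is [c' r' + C W]. *)
exists (row_mx c' (C - c' *m r *m C)); rewrite -mulmxA.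
have -> : row_mx c' (C - c' *m r *m C) *m col_mx r W = c' *m r' + C *m W.
  by rewrite mul_row_col mulmxBl -r'E mulmxBr !mulmxA addrCA addrC.
rewrite mul_col_mx opp_col_mx add_col_mx !mulmxDr !mulmxA.
move=> x y; rewrite mxE; case: (fintype.split x) => l.
  have -> : r - (r *m c' *m r' + r *m C *m W) = (1%:M - r *m c') *m r'.
    by rewrite mulmxBl mul1mx opprD addrCA addrC r'E.
  exact: mx_mod_mull.
rewrite opprD addrCA; apply: mx_modD => //; apply: mx_modN.
exact: mx_mod_mull.
Qed.

End MatricesModIdeal.

(** * Inverting [1 - M] up to a scalar by a polynomial in [M] *)

Section CayleyHamilton.

(** The value of the characteristic polynomial at 1 is [b = \det (1 - M)], so [X - 1] divides
    [char_poly M - b]; evaluating at [M] kills [char_poly M]. Unlike a mere adjugate identity, the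
    polynomial form passes through kernels stable under [M] and through intertwining relations. *)
Lemma Cayley_Hamilton_1sub (R : comNzRingType) n (M : 'M[R]_n) :
  exists N (q : nat -> R),
    (1%:M - M) *m (\sum_(i < N) q i *: M ^+ i) = (\det (1%:M - M))%:M.
Proof.
case: n M => [|n] M; first by exists 0%N, (fun=> 0); apply/matrixP => i; case: i.
pose b := \det (1%:M - M).
have eb : (char_poly M).[1] = b.
  rewrite /char_poly -horner_evalE -det_map_mx; congr determinant.
  apply/matrixP => i j.
  by rewrite !mxE rmorphB rmorphMn /= /horner_eval hornerX hornerC.
have /factor_theorem[q eq] : root (char_poly M - b%:P) 1.
  by rewrite /root !hornerE eb subrr.
exists (size q), (fun i => q`_i).
have -> : \sum_(i < size q) q`_i *: M ^+ i = horner_mx M q.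
  rewrite -[in RHS](coefK q) poly_def rmorph_sum; apply: eq_bigr => i _.
  by rewrite /= horner_mxZ rmorphXn /= horner_mx_X.
have := congr1 (horner_mx M) eq; rewrite mulrC.
rewrite rmorphB /= Cayley_Hamilton horner_mx_C rmorphM rmorphB /= horner_mx_X.
rewrite horner_mx_C sub0r => /(congr1 -%R); rewrite opprK => ->.
by rewrite -mulNr opprB.
Qed.

Lemma Cayley_Hamilton_1sub_mod (R : comPzRingType) (m : R -> Prop) n (M : 'M[R]_n) :
  ideal m -> mx_mod m M ->
  exists b N (q : nat -> R), m (1 - b) /\
    (1%:M - M) *m (\sum_(i < N) q i *: M ^+ i) = b%:M.
Proof.
move=> mI mM; exists (\det (1%:M - M)).
(* In the zero ring all matrices agree; otherwise [R] is repackaged as a nonzero ring to meet the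
   hypothesis of the previous lemma. *)
have [R0|R1] := eqVneq (1 : R) 0.
  exists 0%N, (fun=> 0); split; first exact: det_1sub_mod.
  by apply/matrixP => i j; rewrite -[LHS]mul1r -[RHS]mul1r R0 !mul0r.
pose R' : comNzRingType := HB.pack (GRing.ComPzRing.sort R)
  (GRing.PzSemiRing_isNonZero.Build R R1) R.
have [N [q qP]] := @Cayley_Hamilton_1sub R' n M.
by exists N, q; split; [exact: det_1sub_mod | exact: qP].
Qed.

End CayleyHamilton.

(** * Finite presentations by matrices *)

Section Presentations.
Variable R : comPzRingType.
Implicit Types (M N V P : lmodType R) (m : R -> Prop).

Lemma lin_rV n V (f : 'rV[R]_n -> V) c :
  lin f -> f c = \sum_(i < n) c 0 i *: f (delta_mx 0 i).
Proof.
move=> lf; rewrite [in LHS](row_sum_delta c) (lin_sum _ _ lf).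
by apply: eq_bigr => i _; rewrite linZ.
Qed.

Lemma lin_rV_sum n V (v : 'I_n -> V) : lin (fun c : 'rV[R]_n => \sum_(i < n) c 0 i *: v i).
Proof.
move=> a x y; rewrite scaler_sumr -big_split; apply: eq_bigr => i _ /=.
by rewrite !mxE scalerDl scalerA.
Qed.

Lemma sum_delta n V (v : 'I_n -> V) i :
  \sum_(l < n) (delta_mx 0 i : 'rV[R]_n) 0 l *: v l = v i.
Proof.
rewrite (bigD1 i) //= mxE !eqxx scale1r big1 ?addr0 // => l li.
by rewrite mxE (negPf li) andbF scale0r.
Qed.

Lemma lin_rV_ext n V (f g : 'rV[R]_n -> V) :
  lin f -> lin g -> (forall i, f (delta_mx 0 i) = g (delta_mx 0 i)) -> f =1 g.
Proof.
move=> lf lg e c; rewrite (lin_rV c lf) (lin_rV c lg).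
by apply: eq_bigr => i _; rewrite e.
Qed.

Lemma projective_rV n : projective 'rV[R]_n.
Proof.
move=> M N g f lg sg lf.
have [v gv] := choice (fun i => sg (f (delta_mx 0 i))).
exists (fun c : 'rV[R]_n => \sum_(i < n) c 0 i *: v i); split; first exact: lin_rV_sum.
apply: lin_rV_ext => // [|i]; last by rewrite sum_delta.
by apply: lin_comp => //; exact: lin_rV_sum.
Qed.

Lemma lin_mxP n p (f : 'rV[R]_n -> 'rV[R]_p) :
  lin f -> exists E : 'M_(n, p), forall c, f c = c *m E.
Proof.
move=> lf; exists (\matrix_i f (delta_mx 0 i)).
apply: lin_rV_ext => // [|i]; first exact: lin_mulmxr.
by rewrite -rowE rowK.
Qed.

Lemma mx_rows_exist n k p (Q : 'rV[R]_k -> Prop)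
    (X : 'M[R]_(n, p)) (W : 'M_(k, p)) :
  (forall i, exists2 d, Q d & row i X = d *m W) ->
  exists2 D : 'M_(n, k), forall i, Q (row i D) & X = D *m W.
Proof.
move=> h; have [d dP] := choice (fun i => let: ex_intro2 d Qd e := h i in
  ex_intro (fun d => Q d /\ row i X = d *m W) d (conj Qd e)).
exists (\matrix_i d i) => [i|]; first by rewrite rowK; case: (dP i).
by apply/row_matrixP => i; rewrite row_mul rowK; case: (dP i).
Qed.

Lemma mx_rows_span n k p (X : 'M[R]_(n, p)) (W : 'M_(k, p)) :
  (forall i, exists d, row i X = d *m W) -> exists D : 'M_(n, k), X = D *m W.
Proof.
move=> h; have [|D _ ->] := @mx_rows_exist n k p (fun=> True) X W; last by exists D.
by move=> i; have [d] := h i; exists d.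
Qed.

(** Matrix form of a finite presentation: the rows of [W] generate the relations, and linear maps
    act on row vectors from the right. *)
Definition mx_presents M n k (u : 'rV[R]_n -> M) (W : 'M[R]_(k, n)) :=
  [/\ lin u, surj u & forall c, u c = 0 <-> exists d : 'rV_k, c = d *m W].

Definition mx_presented M :=
  exists n k (u : 'rV[R]_n -> M) (W : 'M[R]_(k, n)), mx_presents u W.

Lemma fin_pres_mx M : fin_pres M -> mx_presented M.
Proof.
move=> [n [v [gen [k [w rel]]]]].
exists n, k, (fun c : 'rV[R]_n => \sum_(i < n) c 0 i *: v i), (\matrix_(j, i) w j i).
split=> [|x|c]; first exact: lin_rV_sum.
  have [c ->] := gen x; exists (\row_i c i).
  by apply: eq_bigr => i _; rewrite mxE.
split=> [/rel[d dP]|[d ->]].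
  exists (\row_j d j); apply/rowP => i; rewrite dP !mxE.
  by apply: eq_bigr => l _; rewrite !mxE.
apply/rel; exists (d 0) => i; rewrite mxE.
by apply: eq_bigr => l _; rewrite mxE.
Qed.

Lemma mx_presented_zero : mx_presented 'rV[R]_0.
Proof.
exists 0%N, 0%N, id, 0; split=> [//|x|c]; first by exists x.
by split=> _; [exists 0|]; rewrite ?mulmx0 [LHS]thinmx0 ?[RHS]thinmx0.
Qed.

Lemma mx_presented_prod M N :
  mx_presented M -> mx_presented N -> mx_presented (M * N)%type.
Proof.
move=> [n [k [u [W [lu su ku]]]]] [n' [k' [u' [W' [lu' su' ku']]]]].
exists (n + n')%N, (k + k')%N, (fun c => (u (lsubmx c), u' (rsubmx c))), (block_mx W 0 0 W').
split=> [a x y|[x y]|c].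
- by rewrite !linearP lu lu'.
- have [[c <-] [c' <-]] := (su x, su' y).
  by exists (row_mx c c'); rewrite row_mxKl row_mxKr.
split=> [[/ku[d dP] /ku'[d' dP']]|[d ->]].
  exists (row_mx d d'); rewrite mul_row_block !mulmx0 addr0 add0r.
  by rewrite -dP -dP' hsubmxK.
rewrite -[d]hsubmxK mul_row_block !mulmx0 addr0 add0r row_mxKl row_mxKr.
by congr pair; [apply/ku|apply/ku']; [exists (lsubmx d)|exists (rsubmx d)].
Qed.

Lemma ideal_mul_mx m n V (u : 'rV[R]_n -> V) y :
  ideal m -> lin u -> surj u -> ideal_mul m y ->
  exists2 c, mx_mod m c & y = u c.
Proof.
move=> mI lu su; elim=> [|a x z ma _ [c mc ->]].
  by exists 0; [exact: mx_mod0 | rewrite lin0].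
have [d <-] := su x; exists (a *: d + c); last by rewrite lu.
apply: mx_modD => // i l; rewrite mxE mulrC; exact: idealM.
Qed.

End Presentations.

(** * Direct sums and finitely presented retracts *)

Section PureProjective.
Variable R : comPzRingType.
Implicit Types (M N V P T : lmodType R) (m : R -> Prop).

Section DirectSum.
Variables (I : Type) (F : I -> lmodType R) (S : lmodType R).
Variables (iota : forall i, F i -> S) (dS : is_dsum iota).
Arguments iota : clear implicits.

Lemma dsum_ext N (f g : S -> N) : lin f -> lin g ->
  (forall i x, f (iota i x) = g (iota i x)) -> f =1 g.
Proof.
case: dS => li uS lf lg e s.
have [|h [_ _ hu]] := uS N (fun i x => g (iota i x)).
  by move=> i; apply: lin_comp.
by rewrite (hu f) // (hu g).
Qed.

(** The finite sums form a submodule [U] through which every [iota k] factors. The induced map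
    [S -> U], followed by the inclusion, is the identity by uniqueness. *)
Lemma dsum_finite s : exists r : seq {i : I & F i},
  s = \sum_(u <- r) iota (tag u) (tagged u).
Proof.
case: dS => li uS.
pose P s := exists r : seq {i : I & F i}, s = \sum_(u <- r) iota (tag u) (tagged u).
have P0 : P 0 by exists [::]; rewrite big_nil.
have PD a x y : P x -> P y -> P (a *: x + y).
  move=> [r ->] [r' ->].
  exists ([seq Tagged (fun i => F i : Type) (a *: (tagged u : F (tag u)))
            | u : {i : I & F i} <- r] ++ r').
  rewrite big_cat big_map scaler_sumr; congr (_ + _).
  by apply: eq_bigr => u _; rewrite /= linZ.
have [U [i [lU iU PU]]] := submodule_exists P0 PD.
have /all_tag[f fP] : forall k, {f : F k -> U | lin f /\ forall x, i (f x) = iota k x}.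
  move=> k; apply: cid; apply: lin_lift_inj => // x; apply/PU.
  by exists [:: Tagged (fun i => F i : Type) x]; rewrite big_seq1.
have [|g [lg gf _]] := uS U f; first by move=> k; case: (fP k).
apply/PU; exists (g s).
apply: (dsum_ext (f := fun s => i (g s)) (g := id)) => //.
  exact: lin_comp.
by move=> k x; rewrite gf; case: (fP k).
Qed.

Lemma dsum_proj i : exists p : S -> F i,
  [/\ lin p, forall x, p (iota i x) = x &
      forall k x, k <> i -> p (iota k x) = 0].
Proof.
case: dS => li uS.
(* The identity on the summand [i] and zero on the others; [I] is a bare type, so its equality is
   decided classically and [x] is transported along it. *)
pose f k : F k -> F i := fun x =>
  if pselect (k = i) is left e then ecast z (F z) e x else 0.
have [|p [lp pf _]] := uS (F i) f.
  move=> k; rewrite /f; case: pselect => [e|_]; last exact: lin_zero.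
  by case: _ / e.
exists p; split=> // [x|k x ki]; rewrite pf /f; case: pselect => // e.
by rewrite (Prop_irrelevance e erefl).
Qed.

(** [B] is the product of the [F i] over the distinct indices in [s]. The vanishing outside [s]
    keeps the old part from interfering when a new index is added. *)
Lemma dsum_finite_retract (s : seq I) : (forall i, mx_presented (F i)) ->
  exists (B : lmodType R) (c : S -> B) (g : B -> S), [/\ mx_presented B, lin c, lin g,
    forall i x, List.In i s -> g (c (iota i x)) = iota i x &
    forall i x, ~ List.In i s -> g (c (iota i x)) = 0].
Proof.
case: (dS) => li _ fpF; elim: s => [|k s [B [c [g [fpB lc lg gc1 gc0]]]]].
  exists 'rV[R]_0, (fun=> 0), (fun=> 0).
  by split=> //; [exact: mx_presented_zero | exact: lin_zero | exact: lin_zero].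
have [ks|ks] := pselect (List.In k s).
  exists B, c, g; split=> // i x; last by move=> h; apply: gc0 => ?; apply: h; right.
  by move=> h; apply: gc1; case: h => [<-|].
have [p [lp p1 p0]] := dsum_proj k.
exists (F k * B)%type, (fun y => (p y, c y)), (fun u => iota k u.1 + g u.2).
split.
- exact: mx_presented_prod.
- by move=> a x y; rewrite lp lc.
- move=> a u v /=; rewrite (li k) lg scalerDr !addrA; congr (_ + _).
  by rewrite addrAC.
- move=> i x /= [e|is_]; first by subst i; rewrite p1 gc0 // addr0.
  have ki : i <> k by move=> e; apply: ks; rewrite -e.
  by rewrite p0 // lin0 // add0r gc1.
- move=> i x /= h; rewrite p0; last by move=> e; apply: h; left.
  by rewrite lin0 // add0r gc0 // => ?; apply: h; right.
Qed.

End DirectSum.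

Definition locally_fp_retract T := forall n (x : 'I_n -> T),
  exists (B : lmodType R) (c : T -> B) (g : B -> T),
    [/\ mx_presented B, lin c, lin g & forall i, g (c (x i)) = x i].

(** The images of the [x i] in the direct sum involve only finitely many summands, collected in [J];
    the retract onto these fixes them. *)
Lemma pure_projective_local T : pure_projective T -> locally_fp_retract T.
Proof.
move=> [I [F [S [iota [fpF dS [s [r [ls lr rs]]]]]]]] n x.
have [l lP] := choice (fun i => dsum_finite dS (s (x i))).
pose J := flatten [seq [seq tag u | u <- l i] | i <- enum 'I_n].
have [|B [c [g [fpB lc lg gc1 _]]]] := @dsum_finite_retract _ _ _ _ dS J.
  by move=> i; apply: fin_pres_mx.
exists B, (fun t => c (s t)), (fun b => r (g b)); split=> // [||i].
- exact: lin_comp.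
- exact: lin_comp.
rewrite -[RHS]rs; congr r; rewrite lP (lin_sum _ _ lc) (lin_sum _ _ lg).
have : forall u, List.In u (l i) -> List.In (tag u) J.
  rewrite /J => u ul.
  have : i \in enum 'I_n by rewrite mem_enum.
  elim: (enum 'I_n) => //= i' e IH; rewrite inE => /orP[/eqP<-|/IH ?].
    by apply: List.in_or_app; left; apply: List.in_map.
  by apply: List.in_or_app; right.
elim: (l i) => [|u e IH] sub; first by rewrite !big_nil.
rewrite !big_cons gc1; last by apply: sub; left.
by congr (_ + _); apply: IH => v ve; apply: sub; right.
Qed.

End PureProjective.

(** * Properness of [mT], and lifting maps locally at [m] *)

Section TiltingLocal.
Variable R : comPzRingType.
Implicit Types (A B M N T P : lmodType R) (m : R -> Prop).

Lemma mx_poly_intertwine k n (W : 'M[R]_(k, n)) (M : 'M_k) (E : 'M_n)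
    (N : nat) (q : nat -> R) :
  W *m E = M *m W ->
  W *m (\sum_(i < N) q i *: E ^+ i) = (\sum_(i < N) q i *: M ^+ i) *m W.
Proof.
move=> WE; have WEX i : W *m (E ^+ i) = M ^+ i *m W.
  elim: i => [|i IH]; first by rewrite !expr0 (mulmx1 W) (mul1mx W).
  by rewrite !exprS [W *m _]mulmxA WE -mulmxA IH mulmxA.
rewrite mulmx_sumr mulmx_suml; apply: eq_bigr => i _.
by rewrite -scalemxAr WEX scalemxAl.
Qed.

(** If [mT = T], then [c g] lifts to a matrix [M] over the free cover [u] of [B], with entries in
    [m]. A lift [y] of [c (x i)] has [y (1 - M)] in the kernel of [u], which is stable under [M].
    Multiplying by the polynomial inverse shows that [b] kills every [x i], so [b = 0] while [1 - b]
    lies in [m]. *)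
Lemma ideal_mul_proper T m n (x : 'I_n -> T) :
  locally_fp_retract T -> (forall a, (forall i, a *: x i = 0) -> a = 0) ->
  ideal m -> ~ m 1 -> exists t : T, ~ ideal_mul m t.
Proof.
move=> locT ann mI m1; apply/existsNP => allm.
have [B [c [g [[r [k [u [_ [lu su _]]]]] lc lg gc]]]] := locT _ x.
have /choice[d dP] : forall i, exists d, mx_mod m d /\ c (g (u (delta_mx 0 i))) = u d.
  move=> i; have cm : ideal_mul m (c (g (u (delta_mx 0 i)))).
    exact: ideal_mul_lin.
  have [d md e] := ideal_mul_mx mI lu su cm.
  by exists d.
pose M : 'M[R]_r := \matrix_i d i.
have mM : mx_mod m M by move=> i j; rewrite mxE; case: (dP i).
have uM y : u (y *m M) = c (g (u y)).
  apply: (lin_rV_ext (f := fun y => u (y *m M)) (g := fun y => c (g (u y)))) => [||i].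
  - by apply: lin_comp lu _; exact: lin_mulmxr.
  - by apply: lin_comp lc _; exact: lin_comp.
  by rewrite -rowE rowK; case: (dP i).
have uX i y : u y = 0 -> u (y *m (M ^+ i)) = 0.
  move=> uy; elim: i => [|i IH]; first by rewrite expr0 [_ *m _]mulmx1.
  by rewrite exprSr [_ *m (_ * _)]mulmxA uM IH lin0 // lin0.
have [b [N [q [mb Mq]]]] := Cayley_Hamilton_1sub_mod mI mM.
apply: m1; rewrite -[1]subr0 -[0](ann b) // => i.
have [y uy] := su (c (x i)).
have y0 : u (y *m (1%:M - M)) = 0.
  by rewrite mulmxBr mulmx1 linB // uM uy gc subrr.
have : u (y *m b%:M) = 0.
  rewrite -Mq mulmxA mulmx_sumr (lin_sum _ _ lu) big1 // => l _.
  by rewrite -scalemxAr linZ // uX // scaler0.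
rewrite mul_mx_scalar linZ // uy => /(congr1 g).
by rewrite linZ // gc lin0.
Qed.

Lemma lift_mod_maximal T P0 P1 A B m (j : P1 -> P0) (q : P0 -> T)
    (f : A -> T) (c : T -> B) (g : B -> T) :
  maximal_ideal m -> short_exact j q -> projective P0 ->
  (forall z, ideal_mul m (j z) -> ideal_mul m z) ->
  mx_presented A -> mx_presented B -> lin f -> lin c -> lin g ->
  (forall a, g (c (f a)) = f a) ->
  exists b h, [/\ m (1 - b), lin h & forall a : A, q (h a) = b *: f a].
Proof.
move=> mmax [lj lq ij sq kq] pr0 tor [n' [k' [uA [WA [luA suA kA]]]]].
move=> [n [k [u [W [lu su ku]]]]] lf lc lg gcf.
have mI : ideal m by case: mmax.
(* [gh] lifts [g u] through [q] and [ch] lifts [c q] through [u], so their composite [E0] is a lift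
   of [c g] that factors through [P0]. *)
have [gh [lgh ghP]] : exists gh : 'rV[R]_n -> P0, lin gh /\ forall x, q (gh x) = g (u x).
  by apply: projective_rV => //; exact: lin_comp.
have [ch [lch chP]] : exists ch : P0 -> 'rV[R]_n, lin ch /\ forall x, u (ch x) = c (q x).
  by apply: pr0 => //; exact: lin_comp.
have [E0 E0P] := lin_mxP (lin_comp lch lgh).
have [C mC] := mx_regular_mod mI W mmax.
(* [E] lifts [c g] as [E0] does, and also maps the relations into [m] times the relations,
   because [W (1 - C W)] vanishes modulo [m]. *)
pose E := (1%:M - C *m W) *m E0.
have uW d : u (d *m W) = 0 by apply/ku; exists d.
have uE x : u (x *m E) = c (g (u x)).
  have uE0 y : u (y *m E0) = c (g (u y)) by rewrite -E0P chP ghP.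
  by rewrite /E mulmxA uE0 mulmxBr mulmx1 linB // !mulmxA uW subr0.
have [M mM WE] : exists2 M : 'M_k, forall i, mx_mod m (row i M) & W *m E = M *m W.
  apply: mx_rows_exist => i.
  pose w := row i (W - W *m C *m W).
  have mw : mx_mod m w by move=> a b; rewrite mxE; apply: mC.
  have uw : u w = 0.
    by rewrite /w rowE mulmxBr !mulmxA linB // !uW subrr.
  (* The relation [w] has entries in [m], so [gh w] lies in [mP0] and in the image of [j]; by [tor]
     it comes from [mP1], which [ch j] sends into [m] times the relations. *)
  have [z zP] : exists z, j z = gh w by apply/kq; rewrite ghP uw lin0.
  have : ideal_mul m z.
    apply: tor; rewrite zP (lin_rV w lgh); apply: ideal_mul_sum => l.
    exact: ideal_mul_gen.
  have -> : row i (W *m E) = ch (j z).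
    by rewrite zP E0P /w -row_mul /E mulmxA mulmxBr mulmx1 mulmxA.
  elim=> [|a y y' ma _ [d md e]].
    by exists 0; [exact: mx_mod0 | rewrite (lin0 lj) (lin0 lch) mul0mx].
  have [d' d'P] : exists d', ch (j y) = d' *m W.
    by apply/ku; rewrite chP (_ : q (j y) = 0) ?lin0 //; apply/kq; exists y.
  exists (a *: d' + d); last by rewrite lj lch mulmxDl e -scalemxAl d'P.
  by apply: mx_modD => // s t; rewrite mxE mulrC; apply: idealM.
have {}mM : mx_mod m M by move=> a b; have := mM a 0 b; rewrite mxE.
have [b [N [p [mb Mp]]]] := Cayley_Hamilton_1sub_mod mI mM.
have [ph [lph phP]] : exists ph : 'rV[R]_n' -> 'rV[R]_n,
    lin ph /\ forall x, u (ph x) = c (f (uA x)).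
  by apply: projective_rV => //; apply: lin_comp lc _; exact: lin_comp.
have [Phi PhiP] := lin_mxP lph.
have uPhi x : u (x *m Phi) = c (f (uA x)) by rewrite -PhiP phP.
have [D DP] : exists D : 'M_(n', k), Phi *m (1%:M - E) = D *m W.
  apply: mx_rows_span => i; apply/ku.
  by rewrite rowE mulmxBr mulmx1 mulmxBr mulmxA linB // uE uPhi gcf subrr.
have [Z ZP] : exists Z : 'M_(k', k), WA *m Phi = Z *m W.
  apply: mx_rows_span => i; apply/ku.
  rewrite rowE mulmxA uPhi (_ : uA _ = 0) ?lin0 //.
  by apply/kA; exists (delta_mx 0 i).
pose QE := \sum_(i < N) p i *: E ^+ i; pose QM := \sum_(i < N) p i *: M ^+ i.
have WQ : W *m QE = QM *m W by exact: mx_poly_intertwine.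
(* [Psi] equals [Phi (b - (1 - E) QE)], and [W (b - (1 - E) QE) = (b - (1 - M) QM) W = 0]. Hence
   [Psi] kills the relations of [A], while the subtracted term consists of relations of [B], so
   [Psi] still represents [b] times [c f]. *)
pose Psi := b *: Phi - D *m QM *m W.
have WPsi : WA *m Psi = 0.
  have e1 : WA *m Phi *m (1%:M - E) = Z *m (1%:M - M) *m W.
    by rewrite ZP mulmxBr mulmx1 mulmxBr mulmx1 mulmxBl -!mulmxA WE.
  have e2 : WA *m Phi *m (1%:M - E) = WA *m D *m W by rewrite -!mulmxA DP.
  rewrite /Psi mulmxBr -scalemxAr ZP !mulmxA -[_ *m QM *m W]mulmxA -WQ mulmxA -e2 e1.
  by rewrite -mulmxA WQ mulmxA -(mulmxA Z) Mp mul_mx_scalar scalemxAl subrr.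
have [x0|h [lh hP]] := lin_factor luA suA (lin_mulmxr (m := 1) Psi).
  by move=> /kA[d ->]; rewrite -mulmxA WPsi mulmx0.
exists b, (fun a => gh (h a)); split=> //; first exact: lin_comp.
move=> a; have [x <-] := suA a.
rewrite ghP hP /Psi mulmxBr -scalemxAr linB // linZ // !mulmxA uW subr0 uPhi.
by rewrite linZ // gcf.
Qed.

Lemma pure_projective_lift T P0 P1 A (j : P1 -> P0) (q : P0 -> T) (f : A -> T) :
  locally_fp_retract T -> short_exact j q -> projective P0 -> projective P1 ->
  Ext1_vanishes T T -> (forall m, maximal_ideal m -> exists t : T, ~ ideal_mul m t) ->
  mx_presented A -> lin f -> exists h : A -> P0, lin h /\ forall a, q (h a) = f a.
Proof.
move=> locT ex pr0 pr1 ext proper fpA lf.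
pose J b := exists h : A -> P0, lin h /\ forall a, q (h a) = b *: f a.
have lq : lin q by case: ex.
suff [h [lh hP]] : J 1 by exists h; split=> // a; rewrite hP scale1r.
have JI : ideal J.
  split; first by exists (fun=> 0); split=> [|a]; [exact: lin_zero | rewrite lin0 // scale0r].
  move=> a x y [h [lh hP]] [h' [lh' h'P]]; exists (fun z => a *: h z + h' z).
  split=> [|z]; first by apply: lin_add => //; exact: lin_scale.
  by rewrite lq hP h'P scalerDl scalerA.
(* If [J] were proper, a maximal ideal [m] containing it would contain both [b] and [1 - b] for the
   [b] found locally at [m]. *)
apply: contrapT => J1; have [m [mmax Jm]] := maximal_ideal_exists JI J1.
have [t mt] := proper _ mmax.
case: (fpA) => n [k [u [W [lu su ku]]]].
(* Fixing the images of the generators of [A] suffices to fix all of [f A]. *)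
have [B [c [g [fpB lc lg gc]]]] := locT _ (fun i => f (u (delta_mx 0 i))).
have gcf a : g (c (f a)) = f a.
  have [x <-] := su a.
  apply: (lin_rV_ext (f := fun x => g (c (f (u x)))) (g := fun x => f (u x))) => //.
    by apply: lin_comp lg _; apply: lin_comp lc _; exact: lin_comp.
  exact: lin_comp.
have tor z : ideal_mul m (j z) -> ideal_mul m z by apply: ideal_mul_ker mmax ex pr1 ext mt.
have [b [h [mb lh hP]]] := lift_mod_maximal mmax ex pr0 tor fpA fpB lf lc lg gcf.
have [mI m1 _] := mmax; apply: m1; rewrite -(subrK b 1); apply: idealD => //.
by apply: Jm; exists h.
Qed.

End TiltingLocal.

(** * Projective modules are classical; conclusion *)

Section Main.
Variable R : comPzRingType.
Implicit Types M T : lmodType R.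

Lemma is_dsum_one T : is_dsum (F := fun _ : unit => T) (fun=> id).
Proof.
split=> // N f lf; exists (f tt); split=> [//|[] //|g lg gf s].
exact: gf tt s.
Qed.

Lemma projective_Ext1_vanishes T M : projective T -> Ext1_vanishes T M.
Proof. by move=> pT E i p [_ lp _ sp _]; apply: pT. Qed.

Lemma projective_regular : projective (R^o : lmodType R).
Proof.
move=> M N g f lg sg lf; have [v gv] := sg (f 1).
exists (fun a : R^o => (a : R) *: v); split=> [a x y|x].
  by rewrite scalerDl scalerA.
by rewrite linZ // gv -linZ // /GRing.scale /= mulr1.
Qed.

Lemma fin_pres_regular : fin_pres (R^o : lmodType R).
Proof.
exists 1%N, (fun=> 1); split=> [x|].
  by exists (fun=> x); rewrite big_ord1 /GRing.scale /= mulr1.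
exists 0%N, (fun=> fun=> 0) => c; rewrite big_ord1 /GRing.scale /= mulr1.
split=> [c0|[d dP]]; last by rewrite dP big_ord0.
by exists (fun=> 0) => i; rewrite ord1 c0 big_ord0.
Qed.

Lemma tilting1_regular : tilting1 (R^o : lmodType R).
Proof.
have ex : short_exact (fun _ : 'rV[R]_0 => 0 : R^o) (id : R^o -> R^o).
  split=> //; first exact: lin_zero.
  - by move=> x y _; rewrite [x]thinmx0 [y]thinmx0.
  - by move=> b; exists b.
  by move=> b; split=> [->|[a <-]] //; exists 0.
have ex' : short_exact (id : R^o -> R^o) (fun _ : R^o => 0 : 'rV[R]_0).
  split=> //; first exact: lin_zero.
    by move=> b; exists 0; rewrite [b]thinmx0.
  by move=> b; split=> // _; exists b.
split.
- exists 'rV[R]_0, R^o, (fun=> 0), id; split=> //; first exact: projective_rV.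
  exact: projective_regular.
- by move=> *; apply: projective_Ext1_vanishes; exact: projective_regular.
exists R^o, 'rV[R]_0, id, (fun=> 0); split=> //.
  exists unit, R^o, (fun=> id); split; first exact: is_dsum_one.
  by exists id, id.
exists unit, R^o, (fun=> id); split; first exact: is_dsum_one.
exists (fun=> 0), (fun=> 0); split; [exact: lin_zero | exact: lin_zero |].
by move=> x; rewrite [x]thinmx0.
Qed.

(** The witness is [R] itself: both orthogonal classes consist of all modules. *)
Lemma projective_classical T : projective T -> classical T.
Proof.
move=> pT; exists R^o; split; [exact: fin_pres_regular | exact: tilting1_regular |].
move=> M; split=> _; apply: projective_Ext1_vanishes => //.
exact: projective_regular.
Qed.

(** The family consists of the components of the image of 1 in a direct sum of copies of [T]. A
    scalar [a] killing them kills [f 1], so [f a = 0], and [f] is injective. *)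
Lemma tilting1_faithful_family T : tilting1 T ->
  exists n (x : 'I_n -> T), forall a, (forall i, a *: x i = 0) -> a = 0.
Proof.
move=> [_ _ [T0 [T1 [f [p [[I [S [iota [dS [s [r [ls lr rs]]]]]]] _ ex]]]]]].
have [lf _ jf _ _] := ex; have li := dS.1.
have [l lP] := dsum_finite dS (s (f 1)).
exists (size l), (fun i => tagged (tnth (in_tuple l) i)) => a ax.
apply: (jf (a : R^o) 0); rewrite (lin0 lf).
have -> : f a = a *: f 1 by rewrite -linZ // /GRing.scale /= mulr1.
rewrite -[LHS]rs (linZ ls) lP big_tnth scaler_sumr big1 ?lin0 // => i _.
by rewrite -(linZ (li _)) ax (lin0 (li _)).
Qed.

End Main.

Theorem theorem3p7 (R : comPzRingType) (T : lmodType R) :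
  pure_projective T -> tilting1 T -> projective T /\ classical T.
Proof.
move=> ppT tT; suff pT : projective T by split=> //; exact: projective_classical.
have locT := pure_projective_local ppT.
have [n [x ann]] := tilting1_faithful_family tT.
have proper m : maximal_ideal m -> exists t : T, ~ ideal_mul m t.
  by move=> [mI m1 _]; exact: (ideal_mul_proper locT ann mI m1).
have [[P1 [P0 [j [q [pr1 pr0 ex]]]]] extT _] := tT.
have extTT := extT _ _ _ (is_dsum_one T).
have [I [F [S [iota [fpF dS [s [r [ls lr rs]]]]]]]] := ppT.
have [li uS] := dS; have [_ lq _ sq _] := ex.
have /all_tag[f fP] : forall i, {f : F i -> P0 | lin f /\ forall x, q (f x) = r (iota i x)}.
  move=> i; apply: cid; apply: (pure_projective_lift locT ex pr0 pr1 extTT proper).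
    exact: fin_pres_mx.
  exact: lin_comp.
(* The lifts on the summands glue to [h] with [q h = r], so [h s] is a section of [q]. *)
have [|h [lh hf _]] := uS P0 f; first by move=> i; case: (fP i).
have qh : forall y, q (h y) = r y.
  apply: (dsum_ext dS (f := fun y => q (h y))) => // [|i y]; first exact: lin_comp.
  by rewrite hf; case: (fP i).
(* A map [u] out of [T] is lifted by lifting [u q] from [P0] and restricting along that section. *)
move=> M N g u lg sg lu.
have [v [lv vP]] := pr0 _ _ g (fun y => u (q y)) lg sg (lin_comp lu lq).
exists (fun t => v (h (s t))); split; first by apply: lin_comp lv _; exact: lin_comp.
by move=> t; rewrite vP qh rs.
Qed.
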